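(* Let $m \ge 1$ be a natural number and consider the planar polynomial system $$\dot x = -y, \qquad \dot y = q(x,y), \qquad q(x,y) = x + x^{2m-1} y\,(x^2+y^2).$$ If a real polynomial vector field $(r,s)$ on the plane commutes with the field $(-y,q)$, then there is a constant $c \in \mathbb{R}$ such that $(r,s) = c\,(-y,q)$.
   Context: Two planar vector fields $(p,q)$ and $(r,s)$ (equivalently, the systems $\dot x=p,\ \dot y=q$ and $\dot x=r,\ \dot y=s$) commute if their Lie bracket vanishes identically, i.e. $$r p_x + s p_y - p r_x - q r_y = 0, \qquad r q_x + s q_y - p s_x - q s_y = 0.$$ *)

(* Defs.v *)
From mathcomp Require Import all_boot all_order all_algebra.
From mathcomp Require Import reals.
From mathcomp Require Import mpoly.

Set Implicit Arguments.
Unset Strict Implicit.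
Unset Printing Implicit Defensive.

Import GRing.Theory.
Local Open Scope ring_scope.

Notation xv := (@ord0 1).
Notation yv := (@ord_max 1).

(* Polynomials stand for the functions they induce on the plane: R is infinite,
   so a bracket that is the zero polynomial is one that vanishes identically,
   and formal partial derivatives are the analytic ones. *)
Definition pvfield (R : realType) := ({mpoly R[2]} * {mpoly R[2]})%type.

Definition vf_commute (R : realType) (v w : pvfield R) : Prop :=
  let: (p, q) := v in
  let: (r, s) := w in
  r * p^`M(xv) + s * p^`M(yv) - p * r^`M(xv) - q * r^`M(yv) = 0 /\
  r * q^`M(xv) + s * q^`M(yv) - p * s^`M(xv) - q * s^`M(yv) = 0.

(* The exponent is a truncated subtraction: meant for 0 < m. *)
Definition sys_q (R : realType) (m : nat) : {mpoly R[2]} :=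
  'X_xv + 'X_xv ^+ (2 * m - 1) * 'X_yv * ('X_xv ^+ 2 + 'X_yv ^+ 2).

(* Main.v *)
(** Write [(p, q)] for the given field, [(r, s)] for a field commuting with it,
    and [D = p d/dx + q d/dy].  The determinant [w = p s - q r] satisfies
    [D w = (p_x + q_y) w].  Expanding this in powers of [y], the highest power
    forces [deg_y w <= 3] and leaves five equations in four univariate
    coefficients [w0, ..., w3].  Comparing leading coefficients there shows that
    [w0] is constant, and the remaining equations give [w = 0].  As
    [s = y r_x - q r_y] by the first bracket, [w = 0] becomes the equation
    [y (y r_x - q r_y) + q r = 0] in [r] alone, and another expansion in powers
    of [y] leaves only [r = c y]. *)

Require Import Defs.
From HB Require Import structures.
From mathcomp Require Import all_boot all_order all_algebra.
From mathcomp Require Import reals.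
From mathcomp Require Import mpoly.
From mathcomp Require Import ring zify.

Import GRing.Theory Num.Theory.
Local Open Scope ring_scope.

(** * Univariate tools and the system for the coefficients of the determinant *)

Lemma polyMn_eq0 (V : numDomainType) (a : {poly V}) n :
  a *+ n.+1 = 0 -> a = 0.
Proof. by move/eqP; rewrite -scaler_nat scale_poly_eq0 pnatr_eq0 => /eqP. Qed.

Lemma deriv_eq0_polyC (V : numDomainType) (a : {poly V}) :
  a^`() = 0 -> a = (a`_0)%:P.
Proof.
move=> a'0; apply/polyP => -[|i]; rewrite coefC //=.
have /eqP := congr1 (fun p : {poly V} => p`_i) a'0.
by rewrite coef_deriv coef0 mulrn_eq0 /= => /eqP.
Qed.

Lemma polyXnM_eq0 (V : idomainType) (a : {poly V}) n : 'X^n * a = 0 -> a = 0.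
Proof. by move/eqP; rewrite mulf_eq0 expf_eq0 polyX_eq0 andbF => /eqP. Qed.

(** Serves when a goal is a known equation up to sign, the identity being left to [ring]. *)
Lemma eq_opp0 (V : zmodType) (a b : V) : a = 0 -> b = - a -> b = 0.
Proof. by move=> -> ->; rewrite oppr0. Qed.

(* [p`_(k + d)] stands for the leading coefficient in the hypothesis. *)
Lemma top_coef_size_le (V : nzSemiRingType) (p : {poly V}) d :
  (forall k, (forall i, p`_(k + d + i.+1) = 0) -> p`_(k + d) = 0) ->
  (size p <= d)%N.
Proof.
move=> top; rewrite leqNgt; apply/negP => dp.
have sp : (size p).-1 = ((size p).-1 - d + d)%N.
  by rewrite subnK // -ltnS prednK //; apply: leq_ltn_trans dp.
have : lead_coef p = 0.
  rewrite lead_coefE sp; apply: top => i; rewrite -sp nth_default // addnS.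
  exact: leq_trans (leqSpred _) (leq_addr _ _).
by move/eqP; rewrite lead_coef_eq0 => /eqP p0; rewrite p0 size_poly0 in dp.
Qed.

(* The equations are the coefficients of [y^0, ..., y^4] in [D w = (p_x + q_y) w],
   with [m = n.+1]. *)
Lemma darboux_system_eq0 (V : numDomainType) n (w0 w1 w2 w3 : {poly V}) :
  'X * w1 - 'X ^+ n.*2.+3 * w0 = 0 ->
  w0^`() - 'X * (w2 *+ 2) = 0 ->
  w1^`() - 'X * (w3 *+ 3) - 'X ^+ n.*2.+3 * w2 + 'X ^+ n.*2.+1 * (w0 *+ 3) = 0 ->
  w2^`() - 'X ^+ n.*2.+3 * (w3 *+ 2) + 'X ^+ n.*2.+1 * (w1 *+ 2) = 0 ->
  w3^`() + 'X ^+ n.*2.+1 * w2 = 0 ->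
  [/\ w0 = 0, w1 = 0, w2 = 0 & w3 = 0].
Proof.
move=> e0 e1 e2 e3 e4.
have {e0} w1E : w1 = 'X ^+ n.*2.+2 * w0.
  have X0 : 'X != 0 :> {poly V} by rewrite polyX_eq0.
  apply: (mulfI X0); apply/eqP; rewrite -subr_eq0 mulrA -exprS.
  exact/eqP.
have {e1} e1 : w0^`() = 'X * (w2 *+ 2) by apply/eqP; rewrite -subr_eq0 e1.
(* Doubling [e4] lets [e1] eliminate [w2]. *)
have {e4} e4 : w3^`() *+ 2 + 'X ^+ n.*2 * w0^`() = 0.
  transitivity ((w3^`() + 'X ^+ n.*2.+1 * w2) *+ 2); last by rewrite e4 mul0rn.
  by rewrite e1 exprS; ring.
(* If [w0] had degree d > 0 and leading coefficient e, then [w3] would have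
   leading coefficient e by [e3] but - d e / (2 (d + 2 n)) by [e4]. *)
have s0 : (size w0 <= 1)%N.
  apply: top_coef_size_le => k big.
  (* The only coefficient of [w2] that enters [e3] at degree k + 4n + 4, where [w0] contributes its
     coefficient k + 1. *)
  have w2k : w2`_(k + 1 + n.*2.*2.+4) = 0.
    have := congr1 (fun p : {poly V} => p`_(k + 1 + n.*2.*2.+4).+1) e1.
    rewrite coef_deriv coefXM coefMn /= -!addnS big mul0rn => /esym/eqP.
    by rewrite mulrn_eq0 => /eqP.
  have := congr1 (fun p : {poly V} => p`_(k + n.*2)) e4.
  rewrite coefD coefMn coefXnM !coef_deriv coef0 ltnNge leq_addl /= addnK.
  have := congr1 (fun p : {poly V} => p`_(k + n.*2.*2.+4)) e3.
  rewrite w1E -mulrnAr mulrA -exprD coefD coefB !coefXnM coef_deriv coef0.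
  have -> : ((k + n.*2.*2.+4).+1 = k + 1 + n.*2.*2.+4)%N by lia.
  rewrite w2k mul0rn !ifF; try lia.
  have -> : (k + n.*2.*2.+4 - n.*2.+3 = (k + n.*2).+1)%N by lia.
  have -> : (k + n.*2.*2.+4 - (n.*2.+1 + n.*2.+2) = k.+1)%N by lia.
  rewrite !coefMn -addn1 sub0r addrC => /eqP; rewrite subr_eq0 eqr_pMn2r // => /eqP <-.
  rewrite !addn1 -mulrnA -mulrnDr addnS => /eqP; rewrite mulrn_eq0 => /eqP.
  exact.
have w0E : w0 = (w0`_0)%:P by apply: size1_polyC.
have w20 : w2 = 0.
  move: e1; rewrite w0E derivC => /esym/eqP; rewrite mulf_eq0 polyX_eq0 /= => /eqP.
  exact: polyMn_eq0.
have w3E : w3 = 'X ^+ n.*2 * w0.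
  apply/eqP; rewrite -subr_eq0; apply/eqP.
  apply: (@polyMn_eq0 _ _ 1); apply: (@polyXnM_eq0 _ _ n.*2.+3).
  rewrite w20 deriv0 w1E in e3; apply: (@eq_opp0 _ _ _ e3).
  by rewrite !exprS; ring.
(* In [e2] the two terms 3 x^(2n+1) [w0] cancel; what survives is the derivative of [w1], namely
   (2n+2) x^(2n+1) [w0]. *)
have w00 : w0 = 0.
  apply: (@polyMn_eq0 _ _ n.*2.+1); apply: (@polyXnM_eq0 _ _ n.*2.+1).
  move: e1; rewrite w20 mul0rn mulr0 => w0'0.
  rewrite -[RHS]e2 w20 w3E w1E derivM derivXn w0'0 !exprS.
  by rewrite /=; ring.
by rewrite w3E w1E w00 w20 !mulr0.
Qed.

(** * Expansion of the two equations in powers of y *)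

Section Bivariate.

Variables (V : numDomainType) (n : nat).

Local Notation dx := (map_poly (@deriv V)).

(* [{poly {poly V}}] is V[x][y]: ['X%:P] is x and ['X] is y. *)
Definition biv_q : {poly {poly V}} :=
  'X%:P + ('X ^+ n.*2.+1)%:P * 'X * (('X ^+ 2)%:P + 'X ^+ 2).

Lemma coef_dx (p : {poly {poly V}}) i : (dx p)`_i = (p`_i)^`().
Proof. exact: coef_map. Qed.

Lemma coef_euler (p : {poly {poly V}}) i : (p^`() * 'X)`_i = p`_i *+ i.
Proof. by rewrite coefMX; case: i => [|i]; rewrite ?mulr0n //= coef_deriv. Qed.

Local Definition coefs :=
  (coefD, coefN, coef0, coefCM, coefMXn, coef_dx, coef_euler).

(** With the Euler operator [U] = y r_y, the coefficient of y^i in [U - r] is (i - 1) r_i. The term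
    in y^3 ([U - r]) therefore kills a top coefficient with i >= 2. Then y^0 gives r_0 = 0 and y^3
    gives r_1' = 0. *)
Lemma collinear_biv (r : {poly {poly V}}) :
  'X * ('X * dx r - biv_q * r^`()) + biv_q * r = 0 ->
  exists c : V, r = c%:P%:P * 'X.
Proof.
move=> req.
set U := r^`() * 'X.
have {req} E : dx r * 'X^2 - 'X%:P * (U - r)
   - ('X ^+ n.*2.+3)%:P * ((U - r) * 'X^1)
   - ('X ^+ n.*2.+1)%:P * ((U - r) * 'X^3) = 0.
  rewrite -[RHS]req /biv_q /U -[n.*2.+3]addn2 exprD polyCM.
  by ring.
have C j := congr1 (fun p : {poly {poly V}} => p`_j) E.
have r0 : r`_0 = 0.
  have := C 0; rewrite !coefs /= => E0; apply: (@polyXnM_eq0 _ _ 1).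
  by rewrite -[RHS]E0; ring.
have s2 : (size r <= 2)%N.
  apply: top_coef_size_le => k big.
  apply: (@polyMn_eq0 _ _ k); apply: (@polyXnM_eq0 _ _ n.*2.+1).
  have := C (k + 2 + 3)%N; rewrite !coefs.
  have -> : (k + 2 + 3 - 2 = k + 2 + 1)%N by lia.
  have -> : (k + 2 + 3 - 1 = k + 2 + 2)%N by lia.
  have -> : (k + 2 + 3 - 3 = k + 2)%N by lia.
  rewrite !big.
  rewrite !ifF; try lia.
  rewrite deriv0 !mul0rn => H; apply: (@eq_opp0 _ _ _ H).
  rewrite addn2 !mulrS; ring.
have r2 i : r`_i.+2 = 0 by apply: nth_default; apply: leq_trans s2 _.
have : (r`_1)^`() = 0.
  have := C 3; rewrite !coefs /= !r2 r0 !mul0rn => H.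
  by rewrite -[RHS]H; ring.
move/deriv_eq0_polyC => r1E; exists (r`_1)`_0.
by apply/polyP => -[|[|i]]; rewrite coefCM coefX /= ?mulr0 ?mulr1.
Qed.

(** The term of highest shift is y^2 ([U] - 3w), whose factor i - 3 on w_i is nonzero for i >= 4.
    This bounds the degree in y by 3. *)
Lemma darboux_biv_eq0 (w : {poly {poly V}}) :
  - 'X * dx w + biv_q * w^`() =
    ('X ^+ n.*2.+1)%:P * (('X ^+ 2)%:P + 3%:R * 'X ^+ 2) * w ->
  w = 0.
Proof.
move=> /eqP; rewrite -subr_eq0 => /eqP weq.
set U := w^`() * 'X.
have {weq} E : dx w * 'X^1 - 'X%:P * w^`()
   - ('X ^+ n.*2.+3)%:P * (U - w)
   - ('X ^+ n.*2.+1)%:P * ((U - w *+ 3) * 'X^2) = 0.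
  rewrite -[n.*2.+3]addn2 exprD polyCM.
  by apply: (@eq_opp0 _ _ _ weq); rewrite /biv_q /U; ring.
have C j := congr1 (fun p : {poly {poly V}} => p`_j) E.
have s4 : (size w <= 4)%N.
  apply: top_coef_size_le => k big.
  apply: (@polyMn_eq0 _ _ k); apply: (@polyXnM_eq0 _ _ n.*2.+1).
  have := C (k + 4 + 2)%N; rewrite !coefs coef_deriv -addnS.
  have -> : (k + 4 + 2 - 2 = k + 4)%N by lia.
  have -> : (k + 4 + 2 - 1 = k + 4 + 1)%N by lia.
  rewrite !big.
  rewrite !ifF; try lia.
  rewrite deriv0 !mul0rn => H; apply: (@eq_opp0 _ _ _ H).
  by rewrite addnC mulrnDr !mulrS; ring.
have w4 i : w`_i.+4 = 0 by apply: nth_default; apply: leq_trans s4 _.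
have [|||||w0 w1 w2 w3] := @darboux_system_eq0 V n w`_0 w`_1 w`_2 w`_3.
- have := C 0; rewrite !coefs /= coef_deriv => H; apply: (@eq_opp0 _ _ _ H).
  by ring.
- have := C 1; rewrite !coefs /= coef_deriv => H; rewrite -[RHS]H.
  by ring.
- have := C 2; rewrite !coefs /= !subSS ?subn0 coef_deriv => H; rewrite -[RHS]H.
  by ring.
- have := C 3; rewrite !coefs /= ?subSS ?subn0 coef_deriv !w4 => H; rewrite -[RHS]H.
  by ring.
- have := C 4; rewrite !coefs /= ?subSS ?subn0 coef_deriv !w4 => H; rewrite -[RHS]H.
  by ring.
by apply/polyP => -[|[|[|[|i]]]]; rewrite coef0.
Qed.

(** * Transfer from polynomials in two variables to V[x][y] *)

Definition to_biv : {mpoly V[2]} -> {poly {poly V}} :=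
  mmap (polyC \o polyC) (fun i => if i == xv then 'X%:P else 'X).

HB.instance Definition _ := GRing.RMorphism.on to_biv.

Lemma to_bivX (m : 'X_{1..2}) : to_biv 'X_[m] = ('X ^+ m xv)%:P * 'X ^+ m yv.
Proof.
rewrite /to_biv mmapX /mmap1 big_ord_recl big_ord1 eqxx polyC_exp.
by have -> : lift xv ord0 = yv by apply: val_inj.
Qed.

Lemma to_bivD p q : to_biv (p + q) = to_biv p + to_biv q.
Proof. exact: rmorphD. Qed.

Lemma to_bivN p : to_biv (- p) = - to_biv p.
Proof. exact: rmorphN. Qed.

Lemma to_bivM p q : to_biv (p * q) = to_biv p * to_biv q.
Proof. exact: rmorphM. Qed.

Lemma to_bivZ c p : to_biv (c *: p) = c%:P%:P * to_biv p.
Proof. exact: mmapZ. Qed.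

(** Evaluating the inner variable at x and the outer one at y gives a left inverse. *)
Lemma to_biv_inj : injective to_biv.
Proof.
pose evx : {rmorphism {poly V} -> {mpoly V[2]}} :=
  horner_eval 'X_xv \o map_poly (@mpolyC 2 V).
pose ev : {rmorphism {poly {poly V}} -> {mpoly V[2]}} :=
  horner_eval ('X_yv : {mpoly V[2]}) \o map_poly evx.
have evxC c : evx c%:P = c%:MP by rewrite /evx /= /horner_eval map_polyC hornerC.
have evxX : evx 'X = 'X_xv by rewrite /evx /= /horner_eval map_polyX hornerX.
have evC a : ev a%:P = evx a by rewrite -[LHS]/((map_poly evx _).[_]) map_polyC hornerC.
have evX : ev 'X = 'X_yv by rewrite -[LHS]/((map_poly evx _).[_]) map_polyX hornerX.
apply: (can_inj (g := ev)); elim/mpolyind => [|c m p _ _ IH].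
  by rewrite !rmorph0.
rewrite to_bivD to_bivZ to_bivX rmorphD IH; congr (_ + _).
rewrite [LHS]rmorphM [X in _ * X]rmorphM !evC evxC mul_mpolyC; congr (_ *: _).
rewrite [evx _]rmorphXn [ev _]rmorphXn evxX evX.
rewrite [RHS]mpolyXE_id big_ord_recl big_ord1.
by have -> : lift xv ord0 = yv by apply: val_inj.
Qed.

Lemma to_biv_Xx : to_biv 'X_xv = 'X%:P.
Proof. by rewrite to_bivX !mnm1E /= expr1 expr0 mulr1. Qed.

Lemma to_biv_Xy : to_biv 'X_yv = 'X.
Proof. by rewrite to_bivX !mnm1E /= expr1 expr0 mul1r. Qed.

Lemma to_biv_dx p : to_biv p^`M(xv) = dx (to_biv p).
Proof.
elim/mpolyind: p => [|c m p _ _ IH]; first by rewrite !raddf0.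
rewrite mderivD mderivZ mderivX !rmorphD /= IH !to_bivZ !to_bivX.
apply/polyP => i; rewrite coefD !coef_dx coefD derivD !coefCM !coefXn.
congr (_ + _).
rewrite !mnmBE !mnm1E eqxx subn0 subn1; case: (i == _); last by rewrite !mulr0 deriv0.
by rewrite !mulr1 derivM derivC mul0r add0r derivXn polyC_natr mulr_natl.
Qed.

Lemma to_biv_dy p : to_biv p^`M(yv) = (to_biv p)^`().
Proof.
elim/mpolyind: p => [|c m p _ _ IH]; first by rewrite !raddf0.
rewrite mderivD mderivZ mderivX !rmorphD /= IH !to_bivZ !to_bivX.
rewrite derivD; congr (_ + _).
rewrite !mnmBE !mnm1E eqxx subn0 subn1 !derivM !derivC derivXn.
by rewrite !polyC_natr !mul0r !add0r -[in RHS]mulr_natr; ring.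
Qed.

(** As p = -y has p_x = 0, this is the whole divergence p_x + q_y, the cofactor in
    [darboux_biv_eq0]. *)
Lemma deriv_biv_q :
  biv_q^`() = ('X ^+ n.*2.+1)%:P * (('X ^+ 2)%:P + 3%:R * 'X ^+ 2).
Proof. by rewrite /biv_q !derivE; ring. Qed.

End Bivariate.

(** * Conclusion for commuting fields *)

Lemma to_biv_sys_q (R : realType) n : to_biv R (sys_q R n.+1) = biv_q R n.
Proof.
have e : (2 * n.+1 - 1 = n.*2.+1)%N by lia.
rewrite /sys_q e !(rmorphD, rmorphM, rmorphXn) /= to_biv_Xx to_biv_Xy.
by rewrite /biv_q !polyC_exp !expr2.
Qed.

Theorem theorem4 (R : realType) (m : nat) (hm : (1 <= m)%N)
    (r s : {mpoly R[2]}) :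
  vf_commute (- 'X_yv, sys_q R m) (r, s) ->
  exists c : R, (r, s) = (c *: - 'X_yv, c *: sys_q R m).
Proof.
case: m hm => // n _ [].
have [px py] : ('X_yv : {mpoly R[2]})^`M(xv) = 0 /\ ('X_yv : {mpoly R[2]})^`M(yv) = 1.
  rewrite !mderivX !mnm1E eqxx scale0r scale1r; split=> //.
  have -> : (U_(yv) - U_(yv) = 0 :> 'X_{1..2})%MM by apply/mnmP => i; rewrite !mnmE subnn.
  by rewrite mpolyX0.
(* From here [q] is opaque, known only through its image [tq]. *)
have := to_biv_sys_q R n; move: (sys_q R n.+1) => q tq.
rewrite !mderivN px py => E1 E2.
pose w := - 'X_yv * s - q * r.
have wE : - 'X_yv * w^`M(xv) + q * w^`M(yv) = q^`M(yv) * w.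
  apply/eqP; rewrite -subr_eq0; apply/eqP.
  (* The difference of the two sides is y times the second bracket plus [q] times the first. *)
  transitivity ('X_yv * (r * q^`M(xv) + s * q^`M(yv) - - 'X_yv * s^`M(xv) - q * s^`M(yv)) +
    q * (r * - 0 + s * - 1 - - 'X_yv * r^`M(xv) - q * r^`M(yv))).
    rewrite /w !(mderivB, mderivM, mderivN) px py; ring.
  by rewrite E1 E2 !mulr0 addr0.
have w0 : w = 0.
  apply: (@to_biv_inj R); rewrite rmorph0; apply: (@darboux_biv_eq0 R n).
  rewrite -deriv_biv_q -tq -!to_biv_dy -to_biv_dx -to_biv_Xy.
  by have := congr1 (to_biv R) wE; rewrite !(to_bivD, to_bivM, to_bivN).
have sE : s = 'X_yv * r^`M(xv) - q * r^`M(yv).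
  apply/eqP; rewrite -subr_eq0; apply/eqP.
  by apply: (@eq_opp0 _ _ _ E1); ring.
have [c rE] : exists c : R, to_biv R r = c%:P%:P * 'X.
  apply: (@collinear_biv R n).
  rewrite -tq -to_biv_dy -to_biv_dx -to_biv_Xy.
  have /(congr1 (to_biv R)) : 'X_yv * ('X_yv * r^`M(xv) - q * r^`M(yv)) + q * r = 0.
    by rewrite -sE; apply: (@eq_opp0 _ _ _ w0); rewrite /w; ring.
  by rewrite !(to_bivD, to_bivM, to_bivN) rmorph0.
have {}rE : r = c *: 'X_yv.
  by apply: (@to_biv_inj R); rewrite rE to_bivZ to_biv_Xy.
(* The sign comes from the first component -y of the given field. *)
exists (- c); rewrite sE rE !mderivZ px py scaleNr scalerN opprK.
by rewrite scaler0 mulr0 sub0r -scalerAr mulr1 scaleNr.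
Qed.
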